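(* Let $\mathbb{F}_q$ be a finite field of odd characteristic and let $\epsilon,\delta\in\mathbb{F}_q$ with $\epsilon(\delta^2-\epsilon)\neq 0$, where $\epsilon$ is a square in $\mathbb{F}_q$ with a fixed square root $\sqrt{\epsilon}\in\mathbb{F}_q$, and assume $\chi\big(2\sqrt{\epsilon}(\sqrt{\epsilon}-\delta)\big)=1$. Fix a square root $\sqrt{2\sqrt{\epsilon}(\sqrt{\epsilon}-\delta)}\in\mathbb{F}_q$. Then the Jacobi quartic curve $J_{\epsilon,\delta}: y^2=\epsilon x^4+2\delta x^2+1$ over $\mathbb{F}_q$ has dADD-M formulas with the function $$w(x,y)=8\sqrt{2\sqrt{\epsilon}(\sqrt{\epsilon}-\delta)}\;\frac{x^2y^2(1-\epsilon x^4)^2}{\left(4\sqrt{\epsilon}\,x^2y^2+(1-\epsilon x^4)^2\right)^2}$$ and $$e=\frac{\left(2\sqrt{\epsilon}+\sqrt{2\sqrt{\epsilon}(\sqrt{\epsilon}-\delta)}\right)^2}{2\sqrt{\epsilon}\,\sqrt{2\sqrt{\epsilon}(\sqrt{\epsilon}-\delta)}};$$ that is, $w$ is an inverted Montgomery-like function on $J_{\epsilon,\delta}$ with parameter $e$.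
   Context: $\chi$ is the quadratic character of $\mathbb{F}_q$: for $a\ne0$, $\chi(a)=1$ if $a$ is a square in $\mathbb{F}_q$ and $\chi(a)=-1$ otherwise. The Jacobi quartic curve $J_{\epsilon,\delta}$ is regarded as an elliptic curve through its smooth projective model $X^2=TZ$, $Y^2=\epsilon T^2+2\delta X^2+Z^2$ in $\mathbb{P}^3$ with coordinates $(X:Y:T:Z)$, the affine point $(x,y)$ being $(x:y:x^2:1)$; the points with $Z=0$ are $(0:\pm\sqrt{\epsilon}:1:0)$. The identity is $(0,1)$, $-(x,y)=(-x,y)$, and addition is generically $$(x_1,y_1)+(x_2,y_2)=\left(\frac{x_1y_2+x_2y_1}{1-\epsilon x_1^2x_2^2},\ \frac{(y_1y_2+2\delta x_1x_2)(1+\epsilon x_1^2x_2^2)+2\epsilon x_1x_2(x_1^2+x_2^2)}{(1-\epsilon x_1^2x_2^2)^2}\right).$$ Inverted Montgomery-like function: let $E$ be an elliptic curve over a field $\mathbb{F}$ of characteristic $\neq2$ and $w$ a rational function on $E$ with $w(P)=w(-P)$ for all $P$. View $w(P)$ in $\mathbb{P}^1(\mathbb{F})$ as $(w(P):1)$ if $w$ is regular at $P$ and $(1:0)$ otherwise. For $P_1,P_2\in E(\mathbb{F})$ put $(W_0:Z_0)=w(P_2-P_1)$, $(W_1:Z_1)=w(P_1)$, $(W_2:Z_2)=w(P_2)$, $(W_3:Z_3)=w(P_1+P_2)$, $(W_4:Z_4)=w(2P_1)$. Then $w$ is an inverted Montgomery-like function with parameter $e\in\mathbb{F}$ if for all $P_1,P_2\in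 E(\mathbb{F})$ with $W_0Z_0\neq0$, $$(W_4:Z_4)=\big(4W_1Z_1((W_1+Z_1)^2-eW_1Z_1):(W_1^2-Z_1^2)^2\big),$$ $$(W_3:Z_3)=\big(Z_0(W_1Z_2-W_2Z_1)^2:W_0(W_1W_2-Z_1Z_2)^2\big).$$ (Equivalently $1/w$ is a Montgomery-like function, given by the same formulas with the two coordinates swapped; a curve with such a function is said to have dADD-M formulas.) *)

(* Defs.v *)
From HB Require Import structures.
From mathcomp Require Import all_boot all_order all_algebra.
From mathcomp Require Import ring.
From mathcomp Require Import boolp.
From mathcomp Require Import mpoly.

Set Implicit Arguments.
Unset Strict Implicit.
Unset Printing Implicit Defensive.

Import GRing.Theory.
Local Open Scope ring_scope.

Definition quad_char (F : finFieldType) (a : F) : int :=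
  if a == 0 then 0 else if [exists b : F, b ^+ 2 == a] then 1 else -1.

(* A point of projective space is given by homogeneous coordinates.  A point
   of the projective line is a pair, a point of P^3 a quadruple (X, Y, T, Z);
   nothing below depends on the choice of the coordinates. *)
Definition proj1_eq (F : fieldType) (p q : F * F) : Prop :=
  [/\ p != (0, 0), q != (0, 0) & p.1 * q.2 = q.1 * p.2].

Definition quadruple (F : fieldType) : Type := (F * F * F * F)%type.

Section JacobiQuartic.

Variables (F : fieldType) (eps delta : F).

Definition jq_point (P : quadruple F) : Prop :=
  let: (X, Y, T, Z) := P in
  [/\ P != (0, 0, 0, 0), X ^+ 2 = T * Z
    & Y ^+ 2 = eps * T ^+ 2 + 2 * delta * X ^+ 2 + Z ^+ 2].

Definition jq_affine (x y : F) : quadruple F := (x, y, x ^+ 2, 1).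

Definition jq_opp (P : quadruple F) : quadruple F :=
  let: (X, Y, T, Z) := P in (- X, Y, T, Z).

(* The homogenization of the generic addition formula.  All its coordinates
   vanish exactly when P1 - P2 is one of the two points with Z = 0. *)
Definition jq_add_generic (P1 P2 : quadruple F) : quadruple F :=
  let: (X1, Y1, T1, Z1) := P1 in
  let: (X2, Y2, T2, Z2) := P2 in
  let A := X1 * Y2 + X2 * Y1 in
  let B := Z1 * Z2 - eps * T1 * T2 in
  (A * B,
   (Y1 * Y2 + 2 * delta * X1 * X2) * (Z1 * Z2 + eps * T1 * T2)
     + 2 * eps * X1 * X2 * (T1 * Z2 + T2 * Z1),
   A ^+ 2, B ^+ 2).

(* The homogenization of
     x3 = (x1^2 - x2^2) / (x1 y2 - x2 y1),
     y3 = ((x1^2 + x2^2) (y1 y2 - 2 delta x1 x2)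
             - 2 x1 x2 (1 + eps x1^2 x2^2)) / (x1 y2 - x2 y1)^2,
   another expression of the generic addition on the curve.  By the lemmas
   jq_add_agree and jq_add_complete the two formulas agree wherever both are
   defined and at least one of them is always defined, so that jq_add is the
   regular extension of the generic addition to all pairs of points. *)
Definition jq_add_dual (P1 P2 : quadruple F) : quadruple F :=
  let: (X1, Y1, T1, Z1) := P1 in
  let: (X2, Y2, T2, Z2) := P2 in
  let C := T1 * Z2 - T2 * Z1 in
  let D := X1 * Y2 - X2 * Y1 in
  (C * D,
   (T1 * Z2 + T2 * Z1) * (Y1 * Y2 - 2 * delta * X1 * X2)
     - 2 * X1 * X2 * (Z1 * Z2 + eps * T1 * T2),
   C ^+ 2, D ^+ 2).

Definition jq_add (P1 P2 : quadruple F) : quadruple F :=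
  if jq_add_generic P1 P2 != (0, 0, 0, 0) then jq_add_generic P1 P2
  else jq_add_dual P1 P2.

Definition jq_sub (P1 P2 : quadruple F) : quadruple F := jq_add P1 (jq_opp P2).

Definition varX : {mpoly F[4]} := 'X_(@Ordinal 4 0 isT).
Definition varY : {mpoly F[4]} := 'X_(@Ordinal 4 1 isT).
Definition varT : {mpoly F[4]} := 'X_(@Ordinal 4 2 isT).
Definition varZ : {mpoly F[4]} := 'X_(@Ordinal 4 3 isT).

Definition jq_coord (P : quadruple F) : 'I_4 -> F :=
  let: (X, Y, T, Z) := P in tnth [tuple X; Y; T; Z].

Definition jq_ideal (p : {mpoly F[4]}) : Prop :=
  exists a b : {mpoly F[4]},
    p = a * (varX ^+ 2 - varT * varZ)
        + b * (varY ^+ 2 - (eps *: varT ^+ 2 + (2 * delta) *: varX ^+ 2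
                            + varZ ^+ 2)).

Record jq_ratfun := JQRatfun {
  rf_num : {mpoly F[4]};
  rf_den : {mpoly F[4]};
  rf_deg : nat;
  rf_num_homog : rf_num \is rf_deg.-homog;
  rf_den_homog : rf_den \is rf_deg.-homog;
  rf_den_neq0 : ~ jq_ideal rf_den }.

(* w is regular at P with value v: some quotient f / g of forms of the same
   degree represents w in the function field and has g(P) != 0. *)
Definition jq_has_value (w : jq_ratfun) (P : quadruple F) (v : F) : Prop :=
  exists (k : nat) (f g : {mpoly F[4]}),
    [/\ f \is k.-homog, g \is k.-homog,
        jq_ideal (f * rf_den w - rf_num w * g),
        g.@[jq_coord P] != 0 & v = f.@[jq_coord P] / g.@[jq_coord P]].

Definition jq_eval (w : jq_ratfun) (P : quadruple F) : F * F :=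
  match pselect (exists v, jq_has_value w P v) with
  | left h => (projT1 (cid h), 1)
  | right _ => (1, 0)
  end.

Definition mpoly_opp (p : {mpoly F[4]}) : {mpoly F[4]} :=
  p \mPo [tuple - varX; varY; varT; varZ].

(* w(P) = w(-P) as an identity of rational functions, that is, at all points
   over all extensions of F and not only at the F-rational ones. *)
Definition jq_even (w : jq_ratfun) : Prop :=
  jq_ideal (mpoly_opp (rf_num w) * rf_den w - rf_num w * mpoly_opp (rf_den w)).

Definition inverted_montgomery_like (w : jq_ratfun) (e : F) : Prop :=
  jq_even w /\
  forall P1 P2 : quadruple F, jq_point P1 -> jq_point P2 ->
    let: (W0, Z0) := jq_eval w (jq_sub P2 P1) in
    let: (W1, Z1) := jq_eval w P1 in
    let: (W2, Z2) := jq_eval w P2 in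
    W0 * Z0 != 0 ->
    proj1_eq (jq_eval w (jq_add P1 P1))
      (4 * W1 * Z1 * ((W1 + Z1) ^+ 2 - e * W1 * Z1), (W1 ^+ 2 - Z1 ^+ 2) ^+ 2)
    /\
    proj1_eq (jq_eval w (jq_add P1 P2))
      (Z0 * (W1 * Z2 - W2 * Z1) ^+ 2, W0 * (W1 * W2 - Z1 * Z2) ^+ 2).

Lemma quadruple_neq0 (X Y T Z : F) :
  ((X, Y, T, Z) != (0, 0, 0, 0)) = [|| X != 0, Y != 0, T != 0 | Z != 0].
Proof. by rewrite !xpair_eqE !negb_and !orbA. Qed.

Lemma jq_affineP (x y : F) :
  jq_point (jq_affine x y) <-> y ^+ 2 = eps * x ^+ 4 + 2 * delta * x ^+ 2 + 1.
Proof.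
have xE : (x ^+ 2) ^+ 2 = x ^+ 4 by ring.
rewrite /jq_point /jq_affine quadruple_neq0 oner_eq0 !orbT mulr1 xE expr1n.
by split=> [[_ _]|].
Qed.

Lemma jq_add_affine (x1 y1 x2 y2 : F) :
  let d := 1 - eps * x1 ^+ 2 * x2 ^+ 2 in
  d != 0 ->
  exists2 c : F, c != 0 &
    let: (x3, y3, t3, z3) := jq_affine ((x1 * y2 + x2 * y1) / d)
      (((y1 * y2 + 2 * delta * x1 * x2) * (1 + eps * x1 ^+ 2 * x2 ^+ 2)
         + 2 * eps * x1 * x2 * (x1 ^+ 2 + x2 ^+ 2)) / d ^+ 2) in
    jq_add (jq_affine x1 y1) (jq_affine x2 y2)
      = (c * x3, c * y3, c * t3, c * z3).
Proof.
move=> d d0; exists (d ^+ 2); first by rewrite expf_neq0.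
rewrite /jq_add /jq_affine /jq_add_generic quadruple_neq0 !mulr1 -/d.
rewrite [d ^+ 2 != 0]expf_neq0 // !orbT.
by congr (_, _, _, _); field.
Qed.

(* The numerator and denominator of
     8 t x^2 y^2 (1 - eps x^4)^2 / (4 s x^2 y^2 + (1 - eps x^4)^2)^2,
   cleared of denominators after x = X / Z, y = Y / Z, x^2 = T / Z. *)
Definition jq_w_num (t : F) : {mpoly F[4]} :=
  (8 * t) *: (varX ^+ 2 * varY ^+ 2 * (varZ ^+ 2 - eps *: varT ^+ 2) ^+ 2).

Definition jq_w_den (s : F) : {mpoly F[4]} :=
  ((4 * s) *: (varX ^+ 2 * varY ^+ 2)
     + (varZ ^+ 2 - eps *: varT ^+ 2) ^+ 2) ^+ 2.

Lemma jq_w_numE (t x y : F) :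
  (jq_w_num t).@[jq_coord (jq_affine x y)]
    = 8 * t * (x ^+ 2 * y ^+ 2 * (1 - eps * x ^+ 4) ^+ 2).
Proof.
rewrite /jq_w_num !(mevalZ, mevalM, rmorphXn, mevalB, mevalD, mevalXU) /=.
by rewrite !(tnth_nth 0) /=; ring.
Qed.

Lemma jq_w_denE (s x y : F) :
  (jq_w_den s).@[jq_coord (jq_affine x y)]
    = (4 * s * x ^+ 2 * y ^+ 2 + (1 - eps * x ^+ 4) ^+ 2) ^+ 2.
Proof.
rewrite /jq_w_den !(mevalZ, mevalM, rmorphXn, mevalB, mevalD, mevalXU) /=.
by rewrite !(tnth_nth 0) /=; ring.
Qed.

Lemma var_homog (i : 'I_4) (k : nat) : ('X_i ^+ k : {mpoly F[4]}) \is k.-homog.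
Proof.
have h : ('X_i : {mpoly F[4]}) \is 1.-homog by rewrite dhomogX /= mdeg1.
by have := dhomogMn k h; rewrite mul1n.
Qed.

Lemma jq_w_num_homog (t : F) : jq_w_num t \is 8.-homog.
Proof.
have h : varZ ^+ 2 - eps *: varT ^+ 2 \is 2.-homog.
  by rewrite rpredB ?rpredZ ?var_homog.
apply: rpredZ; apply: (@dhomogM _ _ _ 4 _ 4); last exact: dhomogMn 2 h.
by apply: (@dhomogM _ _ _ 2 _ 2); apply: var_homog.
Qed.

Lemma jq_w_den_homog (s : F) : jq_w_den s \is 8.-homog.
Proof.
have h : varZ ^+ 2 - eps *: varT ^+ 2 \is 2.-homog.
  by rewrite rpredB ?rpredZ ?var_homog.
apply: (@dhomogMn _ _ _ 4 _ 2); apply: rpredD; last exact: dhomogMn 2 h.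
by apply: rpredZ; apply: (@dhomogM _ _ _ 2 _ 2); apply: var_homog.
Qed.

Lemma jq_ideal_eval (p : {mpoly F[4]}) (P : quadruple F) :
  jq_point P -> jq_ideal p -> p.@[jq_coord P] = 0.
Proof.
move: P => [[[X Y] T] Z] [_ x y] [a [b ->]].
rewrite !(mevalZ, mevalM, rmorphXn, mevalB, mevalD, mevalXU) /=.
rewrite !(tnth_nth 0) /= -x subrr mulr0 add0r.
by rewrite -!expr2 y subrr mulr0.
Qed.

Lemma jq_w_den_neq0 (s : F) : ~ jq_ideal (jq_w_den s).
Proof.
have O : jq_point (jq_affine 0 1) by apply/jq_affineP; ring.
move=> /(jq_ideal_eval O)/eqP; rewrite jq_w_denE.
by rewrite !expr0n /= !(mulr0, mul0r, subr0, add0r) !expr1n oner_eq0.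
Qed.

Definition jq_w (s t : F) : jq_ratfun :=
  JQRatfun (jq_w_num_homog t) (jq_w_den_homog s) (@jq_w_den_neq0 s).

Hypothesis char2 : 2%N \notin [pchar F].
Hypothesis nonsing : eps * (delta ^+ 2 - eps) != 0.

Let two_neq0 : 2 != 0 :> F.
Proof. by apply: contraNneq char2 => h; rewrite inE /= h eqxx. Qed.

Lemma jq_add_complete (P1 P2 : quadruple F) : jq_point P1 -> jq_point P2 ->
  jq_add P1 P2 != (0, 0, 0, 0).
Proof.
move: P1 P2 => [[[X1 Y1] T1] Z1] [[[X2 Y2] T2] Z2].
move=> [n1 x1 y1] [n2 x2 y2]; rewrite !quadruple_neq0 in n1 n2.
rewrite /jq_add; case: ifP => [//|/negbT]; rewrite /jq_add_generic /jq_add_dual !quadruple_neq0.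
rewrite !negb_or !negbK => /and4P[_ _]; rewrite !expf_eq0 /= => /eqP A0 /eqP B0.
apply/negPn/negP; rewrite !negb_or !negbK => /and4P[_ _].
move=> /eqP C0 /eqP D0.
have e0 : eps != 0 by apply: contraNneq nonsing => ->; rewrite mul0r.
have XY1 : X1 * Y2 = 0.
  apply: (mulfI two_neq0); rewrite mulr0.
  have -> : 2 * (X1 * Y2) = (X1 * Y2 + X2 * Y1) + (X1 * Y2 - X2 * Y1) by ring.
  by rewrite A0 D0 addr0.
have XY2 : X2 * Y1 = 0 by move: A0; rewrite XY1 add0r.
have nTZ X Y T Z : [|| X != 0, Y != 0, T != 0 | Z != 0] ->
    X ^+ 2 = T * Z -> Y ^+ 2 = eps * T ^+ 2 + 2 * delta * X ^+ 2 + Z ^+ 2 ->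
    ~ (T = 0 /\ Z = 0).
  move=> n x y [t0 z0]; move: x y; rewrite t0 z0 !mulr0 => x0.
  rewrite x0 !(expr0n, mulr0, addr0) => /eqP; rewrite expf_eq0 /= => /eqP y0.
  by move/eqP: x0; rewrite expf_eq0 /= => /eqP x0; move: n; rewrite x0 y0 t0 z0 eqxx.
(* T2, Z2 solve a linear system with determinant +-(Z1^2 - eps T1^2) *)
have key X1' Y1' T1' Z1' X2' Y2' T2' Z2' :
    [|| X1' != 0, Y1' != 0, T1' != 0 | Z1' != 0] ->
    X1' ^+ 2 = T1' * Z1' ->
    Y1' ^+ 2 = eps * T1' ^+ 2 + 2 * delta * X1' ^+ 2 + Z1' ^+ 2 ->
    [|| X2' != 0, Y2' != 0, T2' != 0 | Z2' != 0] ->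
    X2' ^+ 2 = T2' * Z2' ->
    Y2' ^+ 2 = eps * T2' ^+ 2 + 2 * delta * X2' ^+ 2 + Z2' ^+ 2 ->
    Z1' * Z2' - eps * T1' * T2' = 0 -> T1' * Z2' - T2' * Z1' = 0 ->
    Z1' ^+ 2 = eps * T1' ^+ 2 /\ X1' != 0.
  move=> m1 u1 v1 m2 u2 v2 B C.
  have E : Z1' ^+ 2 = eps * T1' ^+ 2.
    apply/eqP; rewrite -subr_eq0; apply/negPn/negP=> dn0.
    apply: (nTZ _ _ _ _ m2 u2 v2); split; apply: (mulfI dn0); rewrite mulr0.
      have -> : (Z1' ^+ 2 - eps * T1' ^+ 2) * T2'
        = T1' * (Z1' * Z2' - eps * T1' * T2') - Z1' * (T1' * Z2' - T2' * Z1')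
        by ring.
      by rewrite B C !mulr0 subr0.
    have -> : (Z1' ^+ 2 - eps * T1' ^+ 2) * Z2'
        = Z1' * (Z1' * Z2' - eps * T1' * T2')
          - eps * T1' * (T1' * Z2' - T2' * Z1') by ring.
    by rewrite B C !mulr0 subr0.
  split=> //; apply/negP=> /eqP X0; move: (u1); rewrite X0 expr0n /= => /esym/eqP.
  rewrite mulf_eq0 => /orP[]/eqP h; apply: (nTZ _ _ _ _ m1 u1 v1); split=> //.
    by move/eqP: E; rewrite h expr0n mulr0 expf_eq0 => /eqP.
  by move/esym/eqP: E; rewrite h expr0n mulf_eq0 (negPf e0) /= expf_eq0 => /eqP.
have [E1 X1n] := key _ _ _ _ _ _ _ _ n1 x1 y1 n2 x2 y2 B0 C0.
have [_ X2n] : Z2 ^+ 2 = eps * T2 ^+ 2 /\ X2 != 0.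
  apply: (key _ _ _ _ _ _ _ _ n2 x2 y2 n1 x1 y1); first by rewrite -B0; ring.
  by rewrite -[0]oppr0 -C0; ring.
have Y10 : Y1 = 0 by move/eqP: XY2; rewrite mulf_eq0 (negPf X2n) => /eqP.
have T1n : T1 != 0.
  by apply: contraNneq X1n => h; rewrite -sqrf_eq0 x1 h mul0r.
have S : eps * T1 + delta * Z1 = 0.
  apply: (mulfI T1n); apply: (mulfI two_neq0); rewrite !mulr0.
  have -> : 2 * (T1 * (eps * T1 + delta * Z1))
    = eps * T1 ^+ 2 + 2 * delta * (T1 * Z1) + eps * T1 ^+ 2 by ring.
  by rewrite -[X in _ + X]E1 -x1 -y1 Y10 expr0n.
move/eqP: nonsing; apply; apply: (mulfI (expf_neq0 2 T1n)); rewrite mulr0.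
have -> : T1 ^+ 2 * (eps * (delta ^+ 2 - eps))
   = delta ^+ 2 * (eps * T1 ^+ 2) - (eps * T1) ^+ 2 by ring.
rewrite -E1 (_ : _ - _ = (delta * Z1 - eps * T1) * (eps * T1 + delta * Z1)).
  by rewrite S mulr0.
by ring.
Qed.

Lemma jq_add_point (P1 P2 : quadruple F) : jq_point P1 -> jq_point P2 ->
  jq_point (jq_add P1 P2).
Proof.
move=> h1 h2; have := jq_add_complete h1 h2; move: h1 h2.
move: P1 P2 => [[[X1 Y1] T1] Z1] [[[X2 Y2] T2] Z2] [_ x1 y1] [_ x2 y2].
have y1' : Y1 ^+ 2 = eps * T1 ^+ 2 + 2 * delta * (T1 * Z1) + Z1 ^+ 2
  by rewrite y1 x1.
have y2' : Y2 ^+ 2 = eps * T2 ^+ 2 + 2 * delta * (T2 * Z2) + Z2 ^+ 2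
  by rewrite y2 x2.
rewrite /jq_add; case: ifP => _ n; split=> //; rewrite ?exprMn 1?mulrC //.
- ring: x1 x2 y1' y2'.
- ring: x1 x2 y1' y2'.
Qed.

Lemma jq_add_agree (P1 P2 : quadruple F) : jq_point P1 -> jq_point P2 ->
  let: (X, Y, T, Z) := jq_add_generic P1 P2 in
  let: (X', Y', T', Z') := jq_add_dual P1 P2 in
  [/\ X * Y' = X' * Y, X * T' = X' * T & X * Z' = X' * Z] /\
  [/\ Y * T' = Y' * T, Y * Z' = Y' * Z & T * Z' = T' * Z].
Proof.
move: P1 P2 => [[[X1 Y1] T1] Z1] [[[X2 Y2] T2] Z2] [_ x1 y1] [_ x2 y2].
have y1' : Y1 ^+ 2 = eps * T1 ^+ 2 + 2 * delta * (T1 * Z1) + Z1 ^+ 2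
  by rewrite y1 x1.
have y2' : Y2 ^+ 2 = eps * T2 ^+ 2 + 2 * delta * (T2 * Z2) + Z2 ^+ 2
  by rewrite y2 x2.
by rewrite /jq_add_generic /jq_add_dual; split; split; ring: x1 x2 y1' y2'.
Qed.

End JacobiQuartic.

(* Main.v *)
Require Import Defs.
From mathcomp Require Import all_boot all_order all_algebra.
From mathcomp Require Import ring mpoly.

Set Implicit Arguments.
Unset Strict Implicit.
Unset Printing Implicit Defensive.

Import GRing.Theory.
Local Open Scope ring_scope.

(** Write [f = 2 t x^2 / (1 + s x^2)^2].  Since [x (2 P) = 2 x y / (1 - eps x^4)]
    one has [w (P) = f (2 P)], and [f] itself obeys the Montgomery-like law:
    on the curve [y^2] and [(1 - s x^2)^2] are [(1 + s x^2)^2] times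
    [1 - (t / 2 s) f] and [1 - (2 s / t) f], so that
    [w = 4 f ((1 + f)^2 - e f) / (1 - f^2)^2]; this is [jq_w_num_double] and
    [jq_w_den_double].

    The doubling law for [w] follows from it at once, because [P + P] has
    [x^2 = (2 x y)^2 / (1 - eps x^4)^2].  For the differential addition, one
    avoids proving that [2 (P1 + P2) = 2 P1 + 2 P2].  Instead, [x^2] at
    [P1 + P2] and at [P2 - P1] are the two roots of a quadratic equation whose
    coefficients only involve [x^2] at [P1] and [P2]
    ([jq_add_sub_symmetric]).  Hence the two values of [f] are the roots of a
    quadratic equation over the values at [P1] and [P2]
    ([sum_diff_rel_f]), and this equation is the one of the Kummer line of a
    Montgomery curve.  The law for [w] is then a formal consequence of it and
    of [w] being the image of [f] under the doubling map ([double_sum_diff]):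
    the product of the images of the two roots is symmetric in them, hence
    rational in the values of [f] at [P1] and [P2].

    All computations are made in homogeneous coordinates, so the degenerate
    positions need no separate treatment: the only facts needed are that
    numerator and denominator of [w] have no common zero on the curve
    ([jq_w_neq0]), so that they give the value of [w] at every point
    ([jq_eval_w]), and that each relation holds up to a nonzero factor. *)

(** * The Kummer line of a Montgomery curve *)

Section MontgomeryDouble.

Variables (F : fieldType) (e : F).

Definition double_num (a b : F) : F := 4 * a * b * ((a + b) ^+ 2 - e * a * b).
Definition double_den (a b : F) : F := (a ^+ 2 - b ^+ 2) ^+ 2.

Lemma double_numZ (k a b : F) :
  double_num (k * a) (k * b) = k ^+ 4 * double_num a b.
Proof. by rewrite /double_num; ring. Qed.

Lemma double_denZ (k a b : F) :
  double_den (k * a) (k * b) = k ^+ 4 * double_den a b.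
Proof. by rewrite /double_den; ring. Qed.

(** With [u = b / a] these are the formulas on the curve
    [y^2 = u^3 + (2 - e) u^2 + u] for the sum and the product of the
    coordinates of [P1 + P2] and [P1 - P2]. *)
Definition sum_diff_rel (mu a1 b1 a2 b2 a3 b3 a0 b0 : F) : Prop :=
  [/\ a3 * a0 = mu * (a1 * b2 - a2 * b1) ^+ 2,
      a3 * b0 + a0 * b3
        = mu * (2 * ((a1 * b2 + a2 * b1) * (a1 * a2 + b1 * b2)
                     + 2 * (2 - e) * (a1 * a2 * b1 * b2)))
    & b3 * b0 = mu * (a1 * a2 - b1 * b2) ^+ 2].

(** Both products below are symmetric in the pairs of indices [3] and [0],
    hence polynomials in the three left-hand sides of [sum_diff_rel]. *)
Lemma double_sum_diff (mu a1 b1 a2 b2 a3 b3 a0 b0 : F) :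
  sum_diff_rel mu a1 b1 a2 b2 a3 b3 a0 b0 ->
  double_num a3 b3 * double_num a0 b0
    = mu ^+ 4 * (double_num a1 b1 * double_den a2 b2
                 - double_num a2 b2 * double_den a1 b1) ^+ 2 /\
  double_den a3 b3 * double_den a0 b0
    = mu ^+ 4 * (double_num a1 b1 * double_num a2 b2
                 - double_den a1 b1 * double_den a2 b2) ^+ 2.
Proof.
case=> hn hm hd; split.
  have -> : double_num a3 b3 * double_num a0 b0
    = 16 * (a3 * a0) * (b3 * b0)
      * ((a3 * a0 - b3 * b0) ^+ 2 + (a3 * b0 + a0 * b3) ^+ 2
         + (2 - e) * (a3 * b0 + a0 * b3) * (a3 * a0 + b3 * b0)
         + (2 - e) ^+ 2 * (a3 * a0) * (b3 * b0)).
    by rewrite /double_num; ring.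
  by rewrite hn hm hd /double_num /double_den; ring.
have -> : double_den a3 b3 * double_den a0 b0
  = ((a3 * a0 + b3 * b0) ^+ 2 - (a3 * b0 + a0 * b3) ^+ 2) ^+ 2.
  by rewrite /double_den; ring.
by rewrite hn hm hd /double_num /double_den; ring.
Qed.

End MontgomeryDouble.

(** * Sums and differences on the Jacobi quartic *)

Section JacobiQuarticLaw.

Variables (F : fieldType) (eps delta : F).
Hypothesis char2 : 2%N \notin [pchar F].
Hypothesis nonsing : eps * (delta ^+ 2 - eps) != 0.

Local Notation point := (jq_point eps delta).

Lemma jq_TZ_neq0 (X Y T Z : F) :
  point (X, Y, T, Z) -> (T != 0) || (Z != 0).
Proof.
case; rewrite quadruple_neq0 => n x y; apply/negPn/negP.
rewrite negb_or !negbK => /andP[/eqP T0 /eqP Z0].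
have X0 : X = 0 by apply/eqP; rewrite -sqrf_eq0 x T0 mul0r.
have Y0 : Y = 0 by apply/eqP; rewrite -sqrf_eq0 y X0 T0 Z0; apply/eqP; ring.
by move: n; rewrite X0 Y0 T0 Z0 eqxx.
Qed.

Lemma jq_opp_point (P : quadruple F) : point P -> point (jq_opp P).
Proof.
move: P => [[[X Y] T] Z] [n x y]; split; rewrite ?sqrrN //.
by move: n; rewrite !quadruple_neq0 oppr_eq0.
Qed.

Definition coordT (P : quadruple F) : F := P.1.2.
Definition coordZ (P : quadruple F) : F := P.2.

Lemma coord_add_neq0 (P1 P2 : quadruple F) : point P1 -> point P2 ->
  (coordT (jq_add eps delta P1 P2) != 0)
    || (coordZ (jq_add eps delta P1 P2) != 0).
Proof.
move=> h1 h2; have := jq_add_point char2 nonsing h1 h2.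
by case: (jq_add _ _ _ _) => [[[X Y] T] Z] /jq_TZ_neq0.
Qed.

Lemma coord_add (X1 Y1 T1 Z1 X2 Y2 T2 Z2 : F) :
  let P3 := jq_add eps delta (X1, Y1, T1, Z1) (X2, Y2, T2, Z2) in
  (coordT P3 = (X1 * Y2 + X2 * Y1) ^+ 2 /\
   coordZ P3 = (Z1 * Z2 - eps * T1 * T2) ^+ 2) \/
  (coordT P3 = (T1 * Z2 - T2 * Z1) ^+ 2 /\
   coordZ P3 = (X1 * Y2 - X2 * Y1) ^+ 2).
Proof. by rewrite /= /jq_add; case: ifP => _; [left|right]. Qed.

(** The dual formula never serves for a doubling: on the diagonal it gives
    [T = Z = 0], which no point of the curve satisfies. *)
Lemma coord_double (X Y T Z : F) : point (X, Y, T, Z) ->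
  let P4 := jq_add eps delta (X, Y, T, Z) (X, Y, T, Z) in
  coordT P4 = (2 * X * Y) ^+ 2 /\ coordZ P4 = (Z ^+ 2 - eps * T ^+ 2) ^+ 2.
Proof.
move=> h /=; have := coord_add_neq0 h h.
case: (coord_add X Y T Z X Y T Z) => /= -[-> ->].
  by move=> _; split; ring.
by rewrite !subrr expr0n eqxx.
Qed.

Lemma symmetric_neq0 (u3 v3 u0 v0 : F) :
  (u3 != 0) || (v3 != 0) -> (u0 != 0) || (v0 != 0) ->
  u3 * u0 = 0 -> u3 * v0 + u0 * v3 = 0 -> v3 * v0 = 0 -> False.
Proof.
have [->|u3n] := eqVneq u3 0 => /= n3 n0.
  rewrite !mul0r add0r => _ /eqP; rewrite mulf_eq0 (negPf n3) orbF => /eqP u00.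
  by move/eqP; rewrite mulf_eq0 (negPf n3); move: n0; rewrite u00 eqxx => /negPf->.
move/eqP; rewrite mulf_eq0 (negPf u3n) => /eqP u00.
rewrite u00 mul0r addr0 => /eqP; rewrite mulf_eq0 (negPf u3n) => /eqP v00.
by move: n0; rewrite u00 v00 eqxx.
Qed.

(** [x^2 = T / Z] at [P1 + P2] and [P2 - P1] satisfies a quadratic equation.
    Put [A, B] for the square roots of the generic [T] and [Z] coordinates of
    the sum and [C, D] for those of the dual formula; the difference has
    [D, B] and [C, A] up to sign, and [A D = B C] on the curve.  So whichever
    formulas are selected, the symmetric functions are proportional to
    [C^2 : A^2 + D^2 : B^2]. *)
Lemma jq_add_sub_symmetric (X1 Y1 T1 Z1 X2 Y2 T2 Z2 : F) :
  let P1 := (X1, Y1, T1, Z1) in let P2 := (X2, Y2, T2, Z2) in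
  let P3 := jq_add eps delta P1 P2 in let P0 := jq_sub eps delta P2 P1 in
  point P1 -> point P2 ->
  exists2 lam : F, lam != 0 &
    [/\ coordT P3 * coordT P0 = lam * (T1 * Z2 - T2 * Z1) ^+ 2,
        coordT P3 * coordZ P0 + coordT P0 * coordZ P3
          = lam * (2 * (T1 * Z1 * Y2 ^+ 2 + T2 * Z2 * Y1 ^+ 2))
      & coordZ P3 * coordZ P0 = lam * (Z1 * Z2 - eps * T1 * T2) ^+ 2].
Proof.
move=> P1 P2 P3 P0 h1 h2.
suff [lam [eT eM eZ]] : exists lam : F,
    [/\ coordT P3 * coordT P0 = lam * (T1 * Z2 - T2 * Z1) ^+ 2,
        coordT P3 * coordZ P0 + coordT P0 * coordZ P3
          = lam * (2 * (T1 * Z1 * Y2 ^+ 2 + T2 * Z2 * Y1 ^+ 2))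
      & coordZ P3 * coordZ P0 = lam * (Z1 * Z2 - eps * T1 * T2) ^+ 2].
  exists lam; last by split.
  apply/eqP=> l0; move: eT eM eZ; rewrite l0 !mul0r.
  have := coord_add_neq0 h1 h2; have := coord_add_neq0 h2 (jq_opp_point h1).
  rewrite -/P3 -/(jq_sub eps delta P2 P1) -/P0.
  by move=> n0 n3; exact: symmetric_neq0 n3 n0.
case: h1 => _ x1 y1; case: h2 => _ x2 y2.
rewrite x1 in y1; rewrite x2 in y2.
have -> : 2 * (T1 * Z1 * Y2 ^+ 2 + T2 * Z2 * Y1 ^+ 2)
    = (X1 * Y2 + X2 * Y1) ^+ 2 + (X1 * Y2 - X2 * Y1) ^+ 2.
  by rewrite -x1 -x2; ring.
have [tz3|tz3] := coord_add X1 Y1 T1 Z1 X2 Y2 T2 Z2;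
have [tz0|tz0] := coord_add X2 Y2 T2 Z2 (- X1) Y1 T1 Z1;
move: tz3 tz0; rewrite -/P1 -/P2 -/P3 -/(jq_opp P1) -/(jq_sub _ _ P2 P1) -/P0;
move=> [-> ->] [-> ->].
- by exists ((Z1 * Z2 - eps * T1 * T2) ^+ 2); split; ring: x1 x2 y1 y2.
- by exists ((X1 * Y2 + X2 * Y1) ^+ 2); split; ring: x1 x2 y1 y2.
- by exists ((X1 * Y2 - X2 * Y1) ^+ 2); split; ring: x1 x2 y1 y2.
- by exists ((T1 * Z2 - T2 * Z1) ^+ 2); split; ring: x1 x2 y1 y2.
Qed.

(** * The function of which w is the double *)

Variables (s t : F).
Hypothesis sqrt_eps : s ^+ 2 = eps.
Hypothesis sqrt_t : t ^+ 2 = 2 * s * (s - delta).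

Local Notation e := ((2 * s + t) ^+ 2 / (2 * s * t)).

Lemma two_neq0 : 2 != 0 :> F.
Proof. by apply: contraNneq char2 => h; rewrite inE /= h eqxx. Qed.

Lemma s_neq0 : s != 0.
Proof. by apply: contraNneq nonsing => h; rewrite -sqrt_eps h expr0n mul0r. Qed.

Lemma t_neq0 : t != 0.
Proof.
apply: contraNneq nonsing => t0; move/esym/eqP: sqrt_t.
rewrite t0 expr0n !mulf_eq0 (negPf two_neq0) (negPf s_neq0) /=.
by rewrite subr_eq0 => /eqP <-; rewrite -sqrt_eps subrr eqxx orbT.
Qed.

Definition f_num (P : quadruple F) : F := 2 * t * coordT P * coordZ P.
Definition f_den (P : quadruple F) : F := (coordZ P + s * coordT P) ^+ 2.

Definition w_num (P : quadruple F) : F :=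
  (jq_w_num eps t).@[jq_coord P].
Definition w_den (P : quadruple F) : F :=
  (jq_w_den eps s).@[jq_coord P].

Lemma w_numE (X Y T Z : F) : w_num (X, Y, T, Z)
  = 8 * t * (X ^+ 2 * Y ^+ 2 * (Z ^+ 2 - eps * T ^+ 2) ^+ 2).
Proof.
rewrite /w_num /jq_w_num.
rewrite !(mevalZ, mevalM, rmorphXn, mevalB, mevalD, mevalXU) /=.
by rewrite !(tnth_nth 0).
Qed.

Lemma w_denE (X Y T Z : F) : w_den (X, Y, T, Z)
  = (4 * s * (X ^+ 2 * Y ^+ 2) + (Z ^+ 2 - eps * T ^+ 2) ^+ 2) ^+ 2.
Proof.
rewrite /w_den /jq_w_den.
rewrite !(mevalZ, mevalM, rmorphXn, mevalB, mevalD, mevalXU) /=.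
by rewrite !(tnth_nth 0).
Qed.

(** With [a / b] for the value of [f], the quadratic factor of the doubling
    formula splits as [(b - (t / 2 s) a) (b - (2 s / t) a)], and the two factors are
    [Y^2] and [(Z - s T)^2] on the curve. *)
Lemma jq_w_num_double (P : quadruple F) : point P ->
  w_num P = double_num e (f_num P) (f_den P).
Proof.
move: P => [[[X Y] T] Z] [_ x y]; rewrite w_numE /double_num.
set a := f_num _; set b := f_den _.
have sn := s_neq0; have tn := t_neq0; have n2 := two_neq0.
have -> : (a + b) ^+ 2 - e * a * b
    = (b - t / (2 * s) * a) * (b - 2 * s / t * a).
  by field; rewrite sn tn n2.
have -> : b - t / (2 * s) * a = Y ^+ 2.
  rewrite y x /a /b /f_num /f_den /coordT /coordZ /= -sqrt_eps.
  have -> : t / (2 * s) * (2 * t * T * Z) = t ^+ 2 / s * T * Z.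
    by field; rewrite sn n2.
  by rewrite sqrt_t; field.
have -> : b - 2 * s / t * a = (Z - s * T) ^+ 2.
  by rewrite /a /b /f_num /f_den /coordT /coordZ /=; field.
by rewrite x /a /b /f_num /f_den /coordT /coordZ /= -sqrt_eps; ring.
Qed.

Lemma jq_w_den_double (P : quadruple F) : point P ->
  w_den P = double_den (f_num P) (f_den P).
Proof.
move: P => [[[X Y] T] Z] [_ x y]; rewrite w_denE /double_den.
rewrite y x /f_num /f_den /coordT /coordZ /=.
have -> : (2 * t * T * Z) ^+ 2 = 4 * (T * Z) ^+ 2 * t ^+ 2 by ring.
by rewrite sqrt_t -sqrt_eps; ring.
Qed.

(** The identity [w (P) = f (2 P)]. *)
Lemma f_double (P : quadruple F) : point P ->
  f_num (jq_add eps delta P P) = w_num P /\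
  f_den (jq_add eps delta P P) = w_den P.
Proof.
move: P => [[[X Y] T] Z] h; rewrite /f_num /f_den.
by have [-> ->] := coord_double h; rewrite w_numE w_denE; split; ring.
Qed.

(** A common zero of numerator and denominator would have
    [X Y = Z^2 - eps T^2 = 0], so its double would have [T = Z = 0]. *)
Lemma jq_w_neq0 (P : quadruple F) : point P -> w_den P = 0 -> w_num P != 0.
Proof.
move: P => [[[X Y] T] Z] h; rewrite w_numE w_denE => /eqP.
rewrite expf_eq0 /= => /eqP d0.
have := coord_add_neq0 h h; have [-> ->] := coord_double h.
have -> : (2 * X * Y) ^+ 2 = 4 * (X ^+ 2 * Y ^+ 2) by ring.
move: d0; move: (X ^+ 2 * Y ^+ 2) ((_ - _) ^+ 2) => u v d0.
have n4 : 4 != 0 :> F by rewrite (natrM _ 2 2) mulf_neq0 ?two_neq0.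
have n8 : 8 != 0 :> F by rewrite (natrM _ 2 4) mulf_neq0 ?two_neq0.
have vE : v = - (4 * s * u) by apply/eqP; rewrite -addr_eq0 addrC d0.
rewrite vE oppr_eq0 !mulf_eq0 (negPf n4) (negPf n8) (negPf s_neq0).
rewrite (negPf t_neq0) /= oppr_eq0 !mulf_eq0 (negPf n4) (negPf s_neq0) /=.
by rewrite !orbb.
Qed.

(** A quotient representing [w] has the value [w_num P / w_den P] wherever
    this makes sense; if [w_den P = 0] then no quotient is regular at [P]. *)
Lemma jq_eval_w (P : quadruple F) : point P ->
  exists2 k : F, k != 0 &
    w_num P = k * (jq_eval (jq_w eps delta s t) P).1 /\
    w_den P = k * (jq_eval (jq_w eps delta s t) P).2.
Proof.
move=> h; set w := jq_w _ _ _ _.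
have val v : jq_has_value w P v -> w_num P = w_den P * v.
  case=> m [f [g [_ _ idl g0 ->]]].
  have /eqP := jq_ideal_eval h idl.
  rewrite mevalB [(f * _).@[_]]mevalM [(_ * g).@[_]]mevalM.
  rewrite -/(w_den P) -/(w_num P).
  rewrite subr_eq0 => /eqP E; apply: (mulIf g0).
  by rewrite -mulrA divfK // -E mulrC.
rewrite /jq_eval; case: boolp.pselect => [ex|nex] /=.
  have vP := projT2 (boolp.cid ex); exists (w_den P); last by rewrite -val ?mulr1.
  by apply/eqP=> d0; have := jq_w_neq0 h d0; rewrite (val _ vP) d0 mul0r eqxx.
have d0 : w_den P = 0.
  apply/eqP/negPn/negP=> dn; case: nex; exists (w_num P / w_den P).
  exists 8, (jq_w_num eps t), (jq_w_den eps s); split=> //.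
  - exact: jq_w_num_homog.
  - exact: jq_w_den_homog.
  - by exists 0, 0; rewrite !mul0r addr0 subrr.
by exists (w_num P); [exact: jq_w_neq0 | rewrite mulr1 mulr0].
Qed.

Lemma jq_w_even : jq_even (jq_w eps delta s t).
Proof.
pose sigma := [tuple - varX F; varY F; varT F; varZ F].
have sX : varX F \mPo sigma = - varX F by exact: comp_mpolyXU.
have sY : varY F \mPo sigma = varY F by exact: comp_mpolyXU.
have sT : varT F \mPo sigma = varT F by exact: comp_mpolyXU.
have sZ : varZ F \mPo sigma = varZ F by exact: comp_mpolyXU.
have opp_num : Defs.mpoly_opp (jq_w_num eps t) = jq_w_num eps t.
  rewrite /Defs.mpoly_opp -/sigma /jq_w_num comp_mpolyZ 2!rmorphM /=.
  rewrite !rmorphXn /= comp_mpolyB comp_mpolyZ !rmorphXn /=.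
  by rewrite sX sY sT sZ sqrrN.
have opp_den : Defs.mpoly_opp (jq_w_den eps s) = jq_w_den eps s.
  rewrite /Defs.mpoly_opp -/sigma /jq_w_den rmorphXn /= comp_mpolyD.
  rewrite comp_mpolyZ rmorphM /= !rmorphXn /= comp_mpolyB comp_mpolyZ.
  by rewrite !rmorphXn /= sX sY sT sZ sqrrN.
rewrite /jq_even /= opp_num opp_den subrr.
by exists 0, 0; rewrite !mul0r addr0.
Qed.

(** [f] is a quadratic function of [x^2], invariant under
    [x^2 -> 1 / (eps x^2)], so the symmetric functions of its values at
    [P1 + P2] and [P2 - P1] come from those of [x^2]. *)
Lemma sum_diff_rel_f (P1 P2 : quadruple F) : point P1 -> point P2 ->
  let P3 := jq_add eps delta P1 P2 in let P0 := jq_sub eps delta P2 P1 in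
  exists2 mu : F, mu != 0 &
    sum_diff_rel e mu (f_num P1) (f_den P1) (f_num P2) (f_den P2)
      (f_num P3) (f_den P3) (f_num P0) (f_den P0).
Proof.
move=> h1 h2 P3 P0; move: P1 P2 h1 h2 @P3 @P0.
move=> [[[X1 Y1] T1] Z1] [[[X2 Y2] T2] Z2] h1 h2 P3 P0.
have [lam l0] := jq_add_sub_symmetric h1 h2; rewrite -/P3 -/P0.
case: h1 => _ x1 y1; case: h2 => _ x2 y2.
have sn := s_neq0; have tn := t_neq0; have n2 := two_neq0.
rewrite /f_num /f_den.
move: (coordT P3) (coordZ P3) (coordT P0) (coordZ P0) => T3 Z3 T0 Z0.
rewrite /coordT /coordZ /= y1 y2 x1 x2 /sum_diff_rel => -[].
have dE : delta = s - t ^+ 2 / (2 * s).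
  by rewrite sqrt_t; field; rewrite sn n2.
rewrite dE -sqrt_eps => eT eM eZ.
exists (lam ^+ 2); first by rewrite expf_neq0.
split.
- have -> : 2 * t * T3 * Z3 * (2 * t * T0 * Z0)
      = 4 * t ^+ 2 * (T3 * T0) * (Z3 * Z0) by ring.
  by rewrite eT eZ; ring.
- have -> : 2 * t * T3 * Z3 * (Z0 + s * T0) ^+ 2
        + 2 * t * T0 * Z0 * (Z3 + s * T3) ^+ 2
      = 2 * t * ((T3 * Z0 + T0 * Z3) * (Z3 * Z0 + s ^+ 2 * (T3 * T0))
                 + 4 * s * (T3 * T0) * (Z3 * Z0)) by ring.
  by rewrite eT eM eZ; field; rewrite sn tn n2.
have -> : (Z3 + s * T3) ^+ 2 * (Z0 + s * T0) ^+ 2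
    = (Z3 * Z0 + s * (T3 * Z0 + T0 * Z3) + s ^+ 2 * (T3 * T0)) ^+ 2 by ring.
by rewrite eT eM eZ; field; rewrite sn n2.
Qed.

(** * The Montgomery-like laws for w *)

Local Notation w := (jq_w eps delta s t).

Lemma jq_eval_neq0 (P : quadruple F) : jq_eval w P != (0, 0).
Proof.
by rewrite /jq_eval; case: boolp.pselect => *; rewrite xpair_eqE oner_eq0 ?andbF.
Qed.

Lemma jq_w_doubling (P : quadruple F) : point P ->
  let: (W1, Z1) := jq_eval w P in
  proj1_eq (jq_eval w (jq_add eps delta P P))
    (double_num e W1 Z1, double_den W1 Z1).
Proof.
move=> h; have h4 := jq_add_point char2 nonsing h h.
have [k k0] := jq_eval_w h; have [l l0] := jq_eval_w h4.
rewrite (jq_w_num_double h4) (jq_w_den_double h4).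
have [-> ->] := f_double h; have := jq_eval_neq0 (jq_add eps delta P P).
case: (jq_eval _ P) => W1 Z1 /=.
case: (jq_eval _ _) => W4 Z4 /= n4 + [eN1 eD1].
rewrite eN1 eD1 double_numZ double_denZ => -[eN eD].
have k4 : k ^+ 4 != 0 by rewrite expf_neq0.
split=> //=; last first.
  apply: (mulfI k4); apply: (mulfI l0).
  transitivity (l * W4 * (k ^+ 4 * double_den W1 Z1)); first by ring.
  by rewrite -eN eD; ring.
apply: contraNneq n4 => -[N0 D0]; move: eN eD.
rewrite N0 D0 mulr0 => /esym/eqP + /esym/eqP.
by rewrite !mulf_eq0 (negPf l0) /= => /eqP -> /eqP ->.
Qed.

Lemma jq_w_diff_addition (P1 P2 : quadruple F) : point P1 -> point P2 ->
  let: (W0, Z0) := jq_eval w (jq_sub eps delta P2 P1) in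
  let: (W1, Z1) := jq_eval w P1 in
  let: (W2, Z2) := jq_eval w P2 in
  W0 * Z0 != 0 ->
  proj1_eq (jq_eval w (jq_add eps delta P1 P2))
    (Z0 * (W1 * Z2 - W2 * Z1) ^+ 2, W0 * (W1 * W2 - Z1 * Z2) ^+ 2).
Proof.
move=> h1 h2.
have h3 := jq_add_point char2 nonsing h1 h2.
have h0 := jq_add_point char2 nonsing h2 (jq_opp_point h1).
have [mu mu0 /double_sum_diff] := sum_diff_rel_f h1 h2.
have [k0 k0n] := jq_eval_w h0; have [k1 k1n] := jq_eval_w h1.
have [k2 k2n] := jq_eval_w h2; have [k3 k3n] := jq_eval_w h3.
rewrite -/(jq_sub eps delta P2 P1) in h0 *.
rewrite -!jq_w_num_double -?jq_w_den_double //.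
have := jq_eval_neq0 (jq_add eps delta P1 P2).
case: (jq_eval _ (jq_sub _ _ _ _)) => W0 Z0 /=.
case: (jq_eval _ P1) => W1 Z1 /=.
case: (jq_eval _ P2) => W2 Z2 /=.
case: (jq_eval _ _) => W3 Z3 /= n3.
move=> [-> ->] [-> ->] [-> ->] [-> ->] [eN eD].
rewrite mulf_eq0 negb_or => /andP[W0n Z0n].
pose kap := mu ^+ 4 * (k1 * k2) ^+ 2.
have kapn : kap != 0 by rewrite !mulf_neq0 // expf_neq0 // mulf_neq0.
have kk : k3 * k0 != 0 by rewrite mulf_neq0.
have {}eN : k3 * k0 * (W3 * W0) = kap * (W1 * Z2 - W2 * Z1) ^+ 2.
  by transitivity (k3 * W3 * (k0 * W0)); [ring | rewrite eN /kap; ring].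
have {}eD : k3 * k0 * (Z3 * Z0) = kap * (W1 * W2 - Z1 * Z2) ^+ 2.
  by transitivity (k3 * Z3 * (k0 * Z0)); [ring | rewrite eD /kap; ring].
move: ((W1 * Z2 - W2 * Z1) ^+ 2) ((W1 * W2 - Z1 * Z2) ^+ 2) eN eD => N D eN eD.
split=> //=; last first.
  apply: (mulfI kapn).
  transitivity (W3 * W0 * (kap * D)); first by ring.
  by rewrite -eD; transitivity (k3 * k0 * (W3 * W0) * (Z3 * Z0));
     [ring | rewrite eN; ring].
apply: contraNneq n3 => -[/eqP + /eqP]; rewrite !mulf_eq0.
rewrite (negPf W0n) (negPf Z0n) /= => /eqP N0 /eqP D0; move: eN eD.
rewrite N0 D0 mulr0 => /eqP + /eqP.
rewrite ![k3 * k0 * _ == 0]mulf_eq0 (negPf kk) /= !mulf_eq0.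
by rewrite (negPf W0n) (negPf Z0n) !orbF => /eqP -> /eqP ->.
Qed.

End JacobiQuarticLaw.

Theorem proposition11 (F : finFieldType) (eps delta s t : F)
  (odd_char : 2%N \notin [pchar F])
  (nonsingular : eps * (delta ^+ 2 - eps) != 0)
  (sqrt_eps : s ^+ 2 = eps)
  (chi1 : quad_char (2 * s * (s - delta)) = 1)
  (sqrt_t : t ^+ 2 = 2 * s * (s - delta)) :
  inverted_montgomery_like (jq_w eps delta s t)
    ((2 * s + t) ^+ 2 / (2 * s * t)).
Proof.
split; first exact: jq_w_even.
move=> P1 P2 h1 h2.
have := jq_w_diff_addition odd_char nonsingular sqrt_eps sqrt_t h1 h2.
have := jq_w_doubling odd_char nonsingular sqrt_eps sqrt_t h1.
case: (jq_eval _ (jq_sub _ _ _ _)) => W0 Z0.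
case: (jq_eval _ P1) => W1 Z1.
case: (jq_eval _ P2) => W2 Z2.
by move=> dbl add WZ; split; [exact: dbl | exact: add].
Qed.
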